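(* Let $\rho\in(0,1)$, $d\ge2$, $c\in\{0,1,\dots,d-1\}$, and consider the FA-1f model in dimension $d$ at density $\rho$ with boundary condition of dimension $c$. For every $\delta>0$ there exists $\alpha_1(\delta)<0$ such that for every $\alpha<\alpha_1(\delta)$ $$\lim_{N\to\infty}\lim_{T\to\infty}\mu^{N,d}_{\alpha,T}\Big(\int_0^Tdt\sum_{i\in\Lambda_N^d}\eta_i(t)\ge(1-\delta)N^dT\Big)=1.$$
   Context: Model. Let $\Lambda_N^d=\{1,\dots,N\}^d$, $\Omega_N^d=\{0,1\}^{\Lambda_N^d}$, and let $\vec e_1,\dots,\vec e_d$ be the canonical basis vectors. The FA-1f process $(\eta(t))_{t\ge0}$ on $\Omega^d_N$ has generator $\mathcal L_N^df(\eta)=\sum_{i\in\Lambda_N^d}c_i(\eta)(f(\eta^i)-f(\eta))$, where $\eta^i$ is $\eta$ flipped at $i$, $c_i(\eta)=r_i(\eta)[\eta_i(1-\rho)+(1-\eta_i)\rho]$ and $r_i(\eta)=1-\prod_{j=1}^d\eta_{i+\vec e_j}\eta_{i-\vec e_j}$, where sites outside $\Lambda_N^d$ are given fixed boundary values. Boundary condition of dimension $c$: the set of boundary sites (sites outside $\Lambda_N^d$ adjacent to $\Lambda_N^d$) with value $0$ is a $c$-dimensional axis-parallel discrete hyperplane of linear size $N$ (so $N^c$ sites) contained in one face of the boundary, all other boundary sites having value $1$; $c=0$ is a single empty boundary site. The process is reversible with respect to the Bernoulli product measure $\nu$ with $\nu(\eta_i=1)=\rho$. $\mathcal A(T)$ is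 the total number of configuration changes (flips) in $\Lambda_N^d$ during $[0,T]$; $\langle\cdot\rangle$ is the expectation over the process with initial law $\nu$; and $\mu^{N,d}_{\alpha,T}(\cdot)=\dfrac{\langle\,\cdot\,\exp(\frac{\alpha}{N^{d-c}}\mathcal A(T))\rangle}{\langle\exp(\frac{\alpha}{N^{d-c}}\mathcal A(T))\rangle}$. *)

(* Defs.v *)
From HB Require Import structures.
From mathcomp Require Import all_boot all_order all_algebra.
From mathcomp Require Import finmap.
From mathcomp Require Import all_classical all_reals all_analysis.
Set Implicit Arguments.
Unset Strict Implicit.
Unset Printing Implicit Defensive.
Import Order.TTheory GRing.Theory Num.Theory.
Import numFieldNormedType.Exports.
Local Open Scope classical_set_scope.
Local Open Scope ring_scope.

(* Z^d *)
Definition lattice (d : nat) := {ffun 'I_d -> int}.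

Definition unit_vec d (j : 'I_d) : lattice d := [ffun k => (k == j)%:R].

(* 'I_N is {0, ..., N-1}: coordinates are shifted by one in [pos], so that the
   image of [pos] is the box {1, ..., N}^d. *)
Definition site (d N : nat) := {ffun 'I_d -> 'I_N}.

Definition pos d N (i : site d N) : lattice d := [ffun k => ((i k).+1)%:Z].

(* true is an occupied site (value 1), false an empty site (value 0). *)
Definition config (d N : nat) := {ffun site d N -> bool}.

(* Occupation at an arbitrary point of Z^d; b gives the values outside the
   box. *)
Definition occ d N (b : lattice d -> bool) (x : config d N) (z : lattice d) : bool :=
  if [pick i | pos i == z] is Some i then x i else b z.

Definition boundary_site d N (z : lattice d) : Prop :=
  (forall i : site d N, z <> pos i) /\
  exists (i : site d N) (j : 'I_d),
    z = pos i + unit_vec j \/ z = pos i - unit_vec j.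

(* The face of direction k is {z_k = 0} or {z_k = N+1}, according to upper.
   In it, the c coordinates in S run over {1, ..., N} and the remaining
   d - 1 - c ones are frozen to those of a. *)
Definition in_hyperplane d N (k : 'I_d) (upper : bool) (S : {set 'I_d})
    (a : site d N) (z : lattice d) : Prop :=
  [/\ z k = (if upper then N.+1 else 0%N)%:Z,
      forall j, j \in S -> 1 <= z j <= N%:Z &
      forall j, j != k -> j \notin S -> z j = pos a j].

Definition boundary_condition d N (c : nat) (b : lattice d -> bool) : Prop :=
  exists (k : 'I_d) (upper : bool) (S : {set 'I_d}) (a : site d N),
    [/\ k \notin S, #|S| = c &
        forall z, boundary_site N z ->
          (b z = false <-> in_hyperplane k upper S a z)].

Section Generator.
Context {R : realType} {d N : nat} (rho : R) (b : lattice d -> bool).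
Implicit Types (x y : config d N) (f : config d N -> R) (i : site d N) (t : R).

Definition flip x i : config d N :=
  [ffun j => if j == i then ~~ x j else x j].

Definition constraint x i : R :=
  1 - \prod_(j < d) ((occ b x (pos i + unit_vec j))%:R *
                     (occ b x (pos i - unit_vec j))%:R).

Definition rate x i : R :=
  constraint x i * ((x i)%:R * (1 - rho) + (1 - (x i)%:R) * rho).

Definition generator f : config d N -> R :=
  fun x => \sum_i rate x i * (f (flip x i) - f x).

(* The Markov semigroup exp(t L), as a power series in the generator. *)
Definition semigroup t f : config d N -> R :=
  fun x => limn (series (fun n => t ^+ n / n`!%:R * iter n generator f x)).

Definition transition t x y : R := semigroup t (fun z => (z == y)%:R) x.

Definition bernoulli_weight x : R := \prod_i (if x i then rho else 1 - rho).

End Generator.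

(* eta is a version of the FA-1f process started from the Bernoulli product
   measure: the Markov jump process with semigroup exp(t L), with cadlag paths
   (for the discrete topology on configurations). *)
Record FA1f_process {R : realType} {d N : nat} (rho : R) (b : lattice d -> bool)
    {disp : measure_display} {W : measurableType disp} (P : probability W R)
    (eta : R -> W -> config d N) : Prop := {
  FA1f_measurable : forall (t : R) x, 0 <= t -> measurable [set w | eta t w = x];
  FA1f_fdd : forall (n : nat) (t : nat -> R) (x : nat -> config d N),
    t 0%N = 0 -> (forall k, t k <= t k.+1) ->
    P [set w | forall k, (k <= n)%N -> eta (t k) w = x k] =
    (bernoulli_weight rho (x 0%N) *
     \prod_(k < n) transition rho b (t k.+1 - t k) (x k) (x k.+1))%:E;
  FA1f_right_continuous : forall w (t : R), 0 <= t ->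
    \forall s \near t^'+, eta s w = eta t w;
  FA1f_left_limits : forall w (t : R), 0 < t ->
    exists x, \forall s \near t^'-, eta s w = x }.

Section Observables.
Context {R : realType} {d N : nat} {disp : measure_display}
  {W : measurableType disp} (P : probability W R) (eta : R -> W -> config d N).

(* Times in ]0, T] at which the configuration differs from its left limit. *)
Definition jump_times (T : R) (w : W) : set R :=
  [set t | 0 < t <= T /\ ~ (\forall s \near t^'-, eta s w = eta t w)].

(* The number of flips: almost surely each jump flips a single site, and there
   are finitely many of them by the cadlag property. *)
Definition activity (T : R) (w : W) : nat := #|` fset_set (jump_times T w)|%fset.

Definition integrated_occupation (T : R) (w : W) : R :=
  \int[lebesgue_measure]_(t in `[0, T]) \sum_i (eta t w i)%:R.

Definition tilt (c : nat) (alpha T : R) (w : W) : R :=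
  expR (alpha / N%:R ^+ (d - c) * (activity T w)%:R).

Definition tilted_mean (c : nat) (alpha T : R) (F : W -> R) : R :=
  fine ('E_P[(fun w => F w * tilt c alpha T w)%R])%E /
  fine ('E_P[tilt c alpha T])%E.

Definition tilted_proba (c : nat) (alpha T : R) (A : set W) : R :=
  tilted_mean c alpha T \1_A.

End Observables.

(* Main.v *)
(* Let L = |alpha| / N^(d-c) be the cost of a flip.  An empty site unblocks a
   neighbour, so the total flip rate is at least (m/2) times the number V of
   empty sites, with m = min(rho, 1 - rho), and the exponential martingale of
   the flip count A gives, with th = (1 - e^-L) m/2,
       < exp(-L A(T) + th \int_0^T V) > <= 1.
   On the complement of the event, \int_0^T V > delta N^d T, so it contributes
   at most exp(-th delta N^d T) to the partition function, and th N^d is of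
   order |alpha| N^c.  Remaining in the full configuration, whose exit rate is
   at most N^c, shows that the partition function is at least
   nu(full) exp(-4 N^c T).  The first bound wins once |alpha| delta m > 16.

   The martingale bound is proved on the skeleton (k T / n)_(k <= n), where the
   finite-dimensional laws make it a bound on powers of a nonnegative matrix;
   flip counts and Riemann sums then converge along every cadlag path. *)
Require Import Defs.
From HB Require Import structures.
From mathcomp Require Import all_boot all_order all_algebra.
From mathcomp Require Import finmap.
From mathcomp Require Import all_classical all_reals all_analysis.
From mathcomp Require Import measurable_realfun ring lra zify.
Set Implicit Arguments.
Unset Strict Implicit.
Unset Printing Implicit Defensive.
Import Order.TTheory GRing.Theory Num.Theory.
Import numFieldNormedType.Exports.
Local Open Scope classical_set_scope.
Local Open Scope ring_scope.

(** * Cadlag paths *)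

Lemma at_rightE (R : realType) (t : R) (Q : R -> Prop) :
  (\forall s \near t^'+, Q s) ->
  exists2 e, 0 < e & forall s, t < s < t + e -> Q s.
Proof.
move=> [e /= e0 H]; exists e => // s /andP[ts se].
by apply: H => //=; rewrite distrC ger0_norm; lra.
Qed.

Lemma at_leftE (R : realType) (t : R) (Q : R -> Prop) :
  (\forall s \near t^'-, Q s) <->
  exists2 e, 0 < e & forall s, t - e < s < t -> Q s.
Proof.
split=> [[e /= e0 H]|[e e0 H]]; exists e => // s /=.
  by move=> /andP[ts se]; apply: H => //=; rewrite ger0_norm; lra.
move=> se st; apply: H; rewrite st andbT; move: se.
by rewrite ger0_norm; lra.
Qed.

(** Let [m] be the supremum of the points up to which [Q] holds throughout: [Q m] comes from [Q a]
    or from the left hypothesis, and the right one would pass beyond [m] if [m < b]. It stands for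
    compactness of the time interval. *)
Lemma real_induction (R : realType) (a b : R) (Q : R -> Prop) :
  a <= b -> Q a ->
  (forall t, a <= t < b -> Q t -> exists2 e, 0 < e &
     forall s, t < s < t + e -> s <= b -> Q s) ->
  (forall t, a < t <= b -> (forall s, a <= s < t -> Q s) -> Q t) ->
  Q b.
Proof.
move=> ab Qa Qr Ql.
pose S := [set t | a <= t <= b /\ forall s, a <= s <= t -> Q s].
have Sa : S a.
  split; first by rewrite lexx ab.
  by move=> s sa; have -> : s = a by apply/eqP; rewrite eq_le andbC.
have ubS : ubound S b by move=> t [/andP[_ ->]].
have hS : has_sup S by split; [exists a | exists b].
set m := sup S.
have am : a <= m by apply: sup_upper_bound.
have mb : m <= b by apply: ge_sup => //; exists a.
have Qlt s : a <= s < m -> Q s.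
  move=> /andP[as_ sm].
  have [u [_ Su] su] := sup_adherent (eps := m - s) ltac:(lra) hS.
  by apply: Su; rewrite as_ /=; move: su; rewrite -/m; lra.
have Qm : Q m.
  have [am'|] := ltP a m; first by apply: Ql; rewrite ?am' ?mb.
  by move=> ma; have -> : m = a by apply/eqP; rewrite eq_le ma.
have [mb'|bm] := ltP m b; last first.
  by have -> : b = m by apply/eqP; rewrite eq_le mb bm.
have [e e0 He] := Qr m ltac:(by rewrite am mb') Qm.
pose u := Num.min b (m + e / 2).
have mu : m < u by rewrite lt_min mb' /=; lra.
have ub : u <= b by rewrite ge_min lexx.
have ue : u < m + e by rewrite gt_min; apply/orP; right; lra.
have : S u.
  split; first by apply/andP; split; lra.
  move=> s /andP[as_ su]; have [sm|] := ltP s m; first by apply: Qlt; rewrite as_.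
  rewrite le_eqVlt => /orP[/eqP <- //|ms].
  by apply: He; [apply/andP; split; lra | lra].
by move=> /(sup_upper_bound hS); rewrite -/m; lra.
Qed.

Lemma dist_le_max (R : realType) (x y M : R) :
  0 <= x <= M -> 0 <= y -> y <= M -> `|x - y| <= M.
Proof.
by move=> /andP[? ?] ? ?; rewrite ler_norml; apply/andP; split; lra.
Qed.

Section CadlagPath.
Context {R : realType} {E : eqType} (f : R -> E).
Hypothesis f_right : forall t : R, 0 <= t -> \forall s \near t^'+, f s = f t.
Hypothesis f_left : forall t : R, 0 < t -> exists x, \forall s \near t^'-, f s = x.

Definition is_jump (t : R) := ~ (\forall s \near t^'-, f s = f t).

(** Real induction from [s]: right continuity carries the value past [u], and the absence of a jump
    carries it from the left of [u] to [u]. *)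
Lemma no_jump_eq (s t : R) : 0 <= s -> s <= t ->
  (forall u, s < u <= t -> ~ is_jump u) -> f s = f t.
Proof.
move=> s0 st nj; symmetry.
apply: (@real_induction _ s t (fun u => f u = f s)) => //.
- move=> u /andP[su ut] fu.
  have [e e0 He] := at_rightE (f_right (le_trans s0 su)).
  by exists e => // v uv _; rewrite He.
- move=> u /andP[su ut] H.
  have /contrapT/at_leftE[e e0 He] := nj u ltac:(by rewrite su ut).
  pose v := Num.max s (u - e / 2).
  have vs : s <= v by rewrite le_max lexx.
  have vu : v < u by rewrite gt_max su /=; lra.
  have ve : u - e < v by rewrite lt_max; apply/orP; right; lra.
  by rewrite -(He v) ?ve ?vu// H// vs.
Qed.

Lemma const_no_jump (s t u : R) : (forall v, s <= v < t -> f v = f s) ->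
  s < u < t -> ~ is_jump u.
Proof.
move=> fc /andP[su ut]; apply; apply/at_leftE; exists (u - s); first by lra.
by move=> v /andP[sv vu]; rewrite !fc //; apply/andP; split; lra.
Qed.

(** The path is constant just after and just before every time. In the real induction, moving right
    thus adds no jump, and reaching [t] from the left adds at most [t] itself. *)
Lemma finite_jumps (T : R) : 0 <= T ->
  exists js : seq R, forall t, 0 < t <= T -> is_jump t -> t \in js.
Proof.
move=> T0.
apply: (@real_induction _ 0 T (fun b => exists js : seq R, forall t, 0 < t <= b -> is_jump t -> t \in js)) => //.
- by exists [::] => t; lra.
- move=> t /andP[t0 tT] [js Hjs].
  have [e e0 He] := at_rightE (f_right t0).
  exists e => // s /andP[ts se] _; exists js => u /andP[u0 us] ju.
  have [ut|tu] := leP u t; first by apply: Hjs => //; rewrite u0.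
  exfalso; apply: (@const_no_jump t (t + e) u) ju.
    move=> v /andP[]; rewrite le_eqVlt => /orP[/eqP<-//|tv ve].
    by apply: He; rewrite tv.
  by rewrite tu (le_lt_trans us).
- move=> t /andP[t0 tT] H.
  have [x /at_leftE[e e0 He]] := f_left t0.
  pose s := Num.max 0 (t - e / 2).
  have s0 : 0 <= s by rewrite le_max lexx.
  have st : s < t by rewrite gt_max t0 /=; lra.
  have se : t - e < s by rewrite lt_max; apply/orP; right; lra.
  have [js Hjs] := H s ltac:(by rewrite s0).
  exists (t :: js) => u /andP[u0 ut] ju; rewrite inE.
  have [us|su] := leP u s; first by rewrite Hjs ?orbT ?u0.
  move: ut; rewrite le_eqVlt => /orP[->//|ut].
  exfalso; apply: (@const_no_jump s t u) ju; last by rewrite su.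
  by move=> v /andP[sv vt]; rewrite !He//; apply/andP; split; lra.
Qed.

Lemma jump_seq (T : R) : 0 <= T ->
  exists2 js : seq R, uniq js & forall t, t \in js <-> 0 < t <= T /\ is_jump t.
Proof.
move=> T0; have [js Hjs] := finite_jumps T0.
exists (undup [seq t <- js | `[< 0 < t <= T /\ is_jump t >]]); first exact: undup_uniq.
move=> t; rewrite mem_undup mem_filter; split=> [/andP[/asboolP//]|[tT jt]].
by rewrite Hjs// andbT; apply/asboolP.
Qed.

(* Real induction on [T]: the path is constant on [t, t + e[ and on ]t - e, t[. *)
Lemma cadlag_measurable (g : E -> R) (T : R) : 0 <= T ->
  measurable_fun `[0, T] (fun t => g (f t)).
Proof.
move=> T0.
apply: (@real_induction _ 0 T (fun b => measurable_fun `[0, b] (g \o f))) => //.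
- by rewrite set_itv1; exact: measurable_fun_set1.
- move=> t /andP[t0 tT] mt.
  have [e e0 He] := at_rightE (f_right t0).
  exists e => // s /andP[ts se] _.
  have -> : `[0, s]%classic = `[0, t]%classic `|` `]t, s]%classic.
    by rewrite -itv_bndbnd_setU// ?bnd_simp// ltW.
  apply/measurable_funU => //; split => //.
  apply: (@eq_measurable_fun _ _ _ _ _ (cst (g (f t)))); last exact: measurable_cst.
  move=> u; rewrite inE/= in_itv/= => /andP[tu us].
  by rewrite He// tu (le_lt_trans us).
- move=> t /andP[t0 tT] H.
  have [x /at_leftE[e e0 He]] := f_left t0.
  pose s := Num.max 0 (t - e / 2).
  have s0 : 0 <= s by rewrite le_max lexx.
  have st : s < t by rewrite gt_max t0 /=; lra.
  have se : t - e < s by rewrite lt_max; apply/orP; right; lra.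
  have ms := H s ltac:(by rewrite s0).
  have -> : `[0, t]%classic = `[0, s]%classic `|` `]s, t[%classic `|` [set t].
    rewrite -itv_bndbnd_setU ?bnd_simp//.
    by rewrite setUitv1// bnd_simp ltW.
  apply/measurable_funU => //; first exact: measurableU.
  split; last exact: measurable_fun_set1.
  apply/measurable_funU => //; split => //.
  apply: (@eq_measurable_fun _ _ _ _ _ (cst (g x))); last exact: measurable_cst.
  move=> u; rewrite inE/= in_itv/= => /andP[su ut].
  by rewrite He// ut andbT (lt_trans se).
Qed.

(** Two distinct points of []s, t]] are strictly closer than [t - s], so the cell holds at most one
    jump; a single jump separates two constant stretches with different values. *)
Lemma count_jumps (T s t : R) (js : seq R) : uniq js ->
  (forall u, u \in js <-> 0 < u <= T /\ is_jump u) -> 0 <= s -> s <= t -> t <= T ->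
  (forall u v, u \in js -> v \in js -> u != v -> t - s <= `|u - v|) ->
  count (fun u => s < u <= t) js = (f s != f t).
Proof.
move=> ujs Hjs s0 st tT gap; rewrite -size_filter.
have := filter_uniq (fun u => s < u <= t) ujs.
have mf u : (u \in [seq u <- js | s < u <= t]) = (s < u <= t) && (u \in js).
  by rewrite mem_filter.
case: (seq.filter _ js) mf => [|u [|v r]] mf /=.
- move=> _; rewrite (no_jump_eq s0 st) ?eqxx// => u sut ju.
  have := mf u; rewrite sut in_nil /= => /esym/negP; apply; apply/Hjs; split => //.
  by move: sut => /andP[su ut]; apply/andP; split; lra.
- move=> _; have := mf u; rewrite mem_head => /esym/andP[/andP[su ut] uj].
  suff -> : f s != f t by [].
  apply/eqP => fst; have [_] := (Hjs u).1 uj; apply.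
  have fut : f u = f t.
    apply: no_jump_eq; [by lra | exact: ut | move=> v /andP[uv vt] jv].
    have := mf v; rewrite inE (gt_eqF uv) => /esym/negP; apply.
    by rewrite (lt_trans su uv) vt/=; apply/Hjs; split => //; apply/andP; split; lra.
  apply/at_leftE; exists (u - s); first by lra.
  move=> v /andP[sv vu]; rewrite fut -fst; symmetry.
  apply: no_jump_eq; [by lra | by lra | move=> w /andP[sw wv] jw].
  have := mf w; rewrite inE (lt_eqF (le_lt_trans wv vu)) => /esym/negP; apply.
  rewrite sw (le_trans wv)/=; last by lra.
  by apply/Hjs; split => //; apply/andP; split; lra.
- rewrite inE negb_or => /andP[/andP[uv _] _].
  have := mf u; rewrite mem_head => /esym/andP[/andP[su ut] uj].
  have := mf v; rewrite !inE eqxx orbT => /esym/andP[/andP[sv vt] vj].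
  suff : `|u - v| < t - s by rewrite ltNge gap.
  by rewrite ltr_norml; apply/andP; split; lra.
Qed.

(** Minimum of the positive entries in the finite list of pairwise distances, with [1] as the
    starting value. *)
Lemma min_gap (js : seq R) :
  exists2 e, 0 < e & forall u v, u \in js -> v \in js -> u != v -> e <= `|u - v|.
Proof.
have [e e0 He] : exists2 e, 0 < e & forall x, x \in [seq `|u - v| | u <- js, v <- js] -> 0 < x -> e <= x.
  elim: [seq _ | u <- _, v <- _] => [|x r [e e0 IH]]; first by exists 1.
  have [x0|x0] := ltP 0 x; last first.
    by exists e => // y; rewrite inE => /orP[/eqP->|/IH//]; lra.
  exists (Num.min x e); first by rewrite lt_min x0.
  move=> y; rewrite inE => /orP[/eqP->|/IH H] y0; first by rewrite ge_min lexx.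
  by rewrite ge_min H// orbT.
exists e => // u v uj vj uv; apply: He; last by rewrite normr_gt0 subr_eq0.
by apply/allpairsP; exists (u, v).
Qed.

Lemma grid_leT (T : R) (n m : nat) : 0 < T -> (m <= n.+1)%N -> m%:R * (T / n.+1%:R) <= T.
Proof.
move=> T0 mn; rewrite mulrCA ger_pMr// ler_pdivrMr ?ltr0Sn// mul1r ler_nat//.
Qed.

Lemma grid_step (h : R) (m : nat) : m.+1%:R * h - m%:R * h = h.
Proof. by rewrite -mulrBl -natrB// subSnn mul1r. Qed.

Lemma count_itv_split (js : seq R) (s t : R) : s <= t ->
  count (fun u => u <= t) js =
    (count (fun u => (u <= s)%R) js + count (fun u => (s < u <= t)%R) js)%N.
Proof.
move=> st; rewrite -!sum1_count [LHS](bigID (fun u => u <= s)) /=.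
congr addn; apply: eq_bigl => u; last by rewrite -ltNge andbC.
by case: (leP u s) => us; rewrite ?andbF ?andbT ?(le_trans us).
Qed.

Lemma count_le0 (T : R) (js : seq R) :
  (forall u, u \in js <-> 0 < u <= T /\ is_jump u) -> count (fun u => u <= 0) js = 0%N.
Proof.
move=> Hjs; apply/eqP; rewrite -leqn0 leqNgt -has_count; apply/hasPn => u /Hjs[/andP[u0 _] _].
by rewrite -ltNge.
Qed.

Lemma card_jump_set (T : R) (js : seq R) : uniq js ->
  (forall u, u \in js <-> 0 < u <= T /\ is_jump u) ->
  #|` fset_set [set t | 0 < t <= T /\ is_jump t]|%fset = size js.
Proof.
move=> ujs Hjs.
have -> : [set t | 0 < t <= T /\ is_jump t] = [set` [fset u in js]%fset].
  by apply/seteqP; split => u /=; rewrite !inE /= Hjs.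
by rewrite set_fsetK card_fseq undup_id.
Qed.

(** Once the mesh is below the least gap between jumps, a cell has different end values exactly when
    it contains a jump, and then only one. *)
Lemma discrete_jump_count (T : R) : 0 < T ->
  \forall n \near \oo,
   (\sum_(k < n.+1) (f (k%:R * (T / n.+1%:R)) != f (k.+1%:R * (T / n.+1%:R))))%N
   = #|` fset_set [set t | 0 < t <= T /\ is_jump t]|%fset.
Proof.
move=> T0; have [js ujs Hjs] := jump_seq (ltW T0).
have [e e0 gap] := min_gap js.
rewrite (card_jump_set ujs Hjs).
have cvgT : T / n.+1%:R @[n --> \oo] --> (0 : R).
  by rewrite -[X in _ --> X](mulr0 T); apply: cvgMr; exact: cvg_harmonic.
near=> n.
set h := T / n.+1%:R.
have h0 : 0 < h by rewrite divr_gt0// ltr0Sn.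
have he : h < e.
  by rewrite /h; near: n; apply: (cvgr_lt 0 cvgT).
have main m : (m <= n.+1)%N ->
    (\sum_(k < m) (f (k%:R * h) != f (k.+1%:R * h)))%N = count (fun u => u <= m%:R * h) js.
  elim: m => [|m IH] mn; first by rewrite big_ord0 mul0r (count_le0 Hjs).
  have mh : m%:R * h <= m.+1%:R * h by rewrite ler_pM2r// ler_nat.
  rewrite big_ord_recr /= IH ?(ltnW mn)// (count_itv_split js mh); congr addn.
  have m0 : 0 <= m%:R * h by rewrite mulr_ge0// ltW.
  rewrite (count_jumps ujs Hjs m0 mh (grid_leT T0 mn))// => u v uj vj uv.
  by rewrite grid_step (le_trans (ltW he))// gap.
rewrite main// mulrCA divff ?mulr1 ?pnatr_eq0//.
rewrite -[RHS](@count_predT _ js); apply: eq_in_count => u /Hjs[/andP[_ ->]] //.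
Unshelve. all: by end_near. Qed.

(** * Riemann sums along a cadlag path *)

Section RiemannSum.
Variables (g : E -> R) (C : R).
Hypothesis g_bound : forall x, 0 <= g x <= C.

Lemma cadlag_integrable (a : R) : 0 <= a ->
  lebesgue_measure.-integrable `[0, a] (EFin \o (g \o f)).
Proof.
move=> a0; apply: measurable_bounded_integrable => //.
- by rewrite /= lebesgue_measure_itv/= lte_fin; case: ifP => // _; rewrite -EFinB ltry.
- exact: cadlag_measurable.
- exists C; split; first by rewrite num_real.
  move=> x Cx y _ /=; have /andP[g0 gC] := g_bound (f y).
  by rewrite ger0_norm// (le_trans gC)// ltW.
Qed.

(** Without a jump in the cell the integrand is constant and the error vanishes; otherwise both
    terms lie in [[0, (t - s) * C]] and the count is at least 1. *)
Lemma integral_step (T s t : R) (js : seq R) :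
  (forall u, u \in js <-> 0 < u <= T /\ is_jump u) -> 0 <= s -> s <= t -> t <= T ->
  `|(t - s) * g (f s) - \int[lebesgue_measure]_(u in `]s, t]) g (f u)|
   <= (t - s) * C * (count (fun u => s < u <= t) js)%:R.
Proof.
move=> Hjs s0 st tT.
have mst : fine (lebesgue_measure `]s, t]%classic) = t - s.
  rewrite lebesgue_measure_itv/= lte_fin; case: ltP => // ts.
  by have -> : t = s; [apply/eqP; rewrite eq_le ts | rewrite subrr].
have cstE c : \int[lebesgue_measure]_(u in `]s, t]) (cst c) u = (t - s) * c.
  by rewrite Rintegral_cst// mst mulrC.
case E0 : (count _ _) => [|m].
  rewrite mulr0.
  have -> : \int[lebesgue_measure]_(u in `]s, t]) g (f u) = \int[lebesgue_measure]_(u in `]s, t]) (cst (g (f s))) u.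
    apply: eq_Rintegral => u; rewrite inE/= in_itv/= => /andP[su ut].
    rewrite (@no_jump_eq s u)// ?(ltW su)// => v /andP[sv vu] jv.
    have /hasPn/(_ v) : ~~ has (fun u => s < u <= t) js by rewrite has_count E0.
    rewrite sv (le_trans vu ut)/= => H.
    have : v \in js by apply/Hjs; split => //; apply/andP; split; lra.
    by move=> /H.
  by rewrite cstE subrr normr0.
have [lo hi] : 0 <= \int[lebesgue_measure]_(u in `]s, t]) g (f u) /\ \int[lebesgue_measure]_(u in `]s, t]) g (f u) <= (t - s) * C.
  split; first by apply: Rintegral_ge0 => u _; have /andP[] := g_bound (f u).
  rewrite -cstE; apply: le_Rintegral => //.
  - apply: (integrableS _ _ _ (cadlag_integrable (le_trans s0 st))) => //.
    by apply: subset_itv; rewrite bnd_simp.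
  - apply: measurable_bounded_integrable => //.
    + by rewrite /= lebesgue_measure_itv/= lte_fin; case: ifP => // _; rewrite -EFinB ltry.
    + by exists `|C|; split; [rewrite num_real | move=> x Cx y _ /=; exact: ltW].
  - by move=> u _; have /andP[] := g_bound (f u).
have /andP[g0 gC] := g_bound (f s).
have C0 : 0 <= C := le_trans g0 gC.
have ts : 0 <= t - s by rewrite subr_ge0.
have tsC : 0 <= (t - s) * g (f s) <= (t - s) * C.
  by rewrite mulr_ge0//= ler_wpM2l.
apply: (@le_trans _ _ ((t - s) * C)); last first.
  by rewrite ler_peMr ?mulr_ge0// ler1n.
exact: dist_le_max.
Qed.

Lemma riemann_sum_error (T : R) (js : seq R) (n m : nat) : 0 < T ->
  (forall u, u \in js <-> 0 < u <= T /\ is_jump u) ->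
  let h := T / n.+1%:R in (m <= n.+1)%N ->
  `|h * (\sum_(k < m) g (f (k%:R * h))) - \int[lebesgue_measure]_(u in `[0, m%:R * h]) g (f u)|
   <= h * C * (count (fun u => u <= m%:R * h) js)%:R.
Proof.
move=> T0 Hjs h.
have h0 : 0 < h by rewrite divr_gt0// ltr0Sn.
elim: m => [|m IH] mn.
  rewrite big_ord0 mulr0 mul0r set_itv1 Rintegral_set1 subrr normr0.
  have /andP[g0 gC] := g_bound (f 0).
  by rewrite mulr_ge0// mulr_ge0// ?(ltW h0)//; lra.
have mh : m%:R * h <= m.+1%:R * h by rewrite ler_pM2r// ler_nat.
have m0 : 0 <= m%:R * h by rewrite mulr_ge0// ltW.
have := integral_step Hjs m0 mh (grid_leT T0 mn).
rewrite grid_step -(@Rintegral_itvB _ _ (BLeft 0)); last 3 first.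
- by apply: cadlag_integrable; lra.
- by rewrite bnd_simp.
- by rewrite bnd_simp.
rewrite (count_itv_split js mh) natrD mulrDr big_ord_recr/= => st.
have := lerD (IH (ltnW mn)) st; apply: le_trans.
apply: le_trans (ler_normD _ _); rewrite le_eqVlt; apply/orP; left; apply/eqP.
by congr Num.norm; ring.
Qed.

(** The total error is at most the mesh times [C] times the number of jumps, which is fixed along
    the path. *)
Lemma riemann_sum_cvg (T : R) : 0 < T ->
  T / n.+1%:R * (\sum_(k < n.+1) g (f (k%:R * (T / n.+1%:R)))) @[n --> \oo] -->
  \int[lebesgue_measure]_(u in `[0, T]) g (f u).
Proof.
move=> T0; have [js ujs Hjs] := jump_seq (ltW T0).
apply/cvgrPdist_le => e e0.
have cvgT : T * (C * (size js)%:R) / n.+1%:R @[n --> \oo] --> (0 : R).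
  by rewrite -[X in _ --> X](mulr0 (T * (C * (size js)%:R))); apply: cvgMr; exact: cvg_harmonic.
near=> n.
have := @riemann_sum_error T js n n.+1 T0 Hjs (leqnn _).
rewrite (mulrCA n.+1%:R) divff ?pnatr_eq0// mulr1 distrC => /le_trans; apply.
have C0 : 0 <= C by have /andP[g0 gC] := g_bound (f 0); lra.
apply: (@le_trans _ _ (T * (C * (size js)%:R) / n.+1%:R)).
  rewrite [leRHS]mulrAC -mulrA ler_wpM2l ?divr_ge0 ?(ltW T0)// ler_wpM2l// ler_nat.
  exact: count_size.
by near: n; apply: (cvgr_le 0 cvgT).
Unshelve. all: by end_near. Qed.

End RiemannSum.
End CadlagPath.

(** * Rates *)

Section Rates.
Local Open Scope set_scope.
Context {R : realType} {d N : nat} (rho : R) (b : lattice d -> bool).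
Hypothesis hrho : 0 < rho < 1.
Implicit Types (x : config d N) (i j : site d N).

Definition full : config d N := [ffun=> true].
Definition occupation x : R := \sum_i (x i)%:R.
Definition exit_rate x : R := \sum_i rate rho b x i.
Definition min_rate : R := Num.min rho (1 - rho).

Lemma min_rate_gt0 : 0 < min_rate.
Proof. by case/andP: hrho => r0 r1; rewrite lt_min r0/= subr_gt0. Qed.

Lemma pos_inj : injective (@pos d N).
Proof.
move=> i j /ffunP ij; apply/ffunP => k; apply/val_inj.
by have := ij k; rewrite !ffunE => -[].
Qed.

Lemma occ_pos x i : occ b x (pos i) = x i.
Proof.
rewrite /occ; case: pickP => [j /eqP/pos_inj -> //|/(_ i)].
by rewrite eqxx.
Qed.

Definition blocked x i : bool :=
  [forall j, occ b x (pos i + unit_vec j) && occ b x (pos i - unit_vec j)].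

Lemma constraintE x i : constraint b x i = (~~ blocked x i)%:R :> R.
Proof.
rewrite /constraint /blocked; case: (boolP [forall j, _]) => [/forallP H|].
  by rewrite big1 ?subrr// => j _; have /andP[-> ->] := H j; rewrite mulr1.
rewrite negb_forall => /existsP[j]; rewrite negb_and => H.
rewrite (bigD1 j)//=; case/orP: H => /negbTE ->; by rewrite ?mul0r ?mulr0 ?mul0r subr0.
Qed.

Lemma rate_bounds x i :
  min_rate * (~~ blocked x i)%:R <= rate rho b x i <= (~~ blocked x i)%:R.
Proof.
rewrite /rate constraintE.
case: (~~ blocked x i); last by rewrite mulr0 mul0r lexx.
rewrite mulr1 mul1r; have /andP[r0 r1] := hrho.
have m1 : min_rate <= rho by rewrite ge_min lexx.
have m2 : min_rate <= 1 - rho by rewrite ge_min lexx orbT.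
by case: (x i); rewrite /= ?subr0 ?subrr ?mul0r ?mul1r ?addr0 ?add0r; apply/andP; split; lra.
Qed.

Lemma rate_ge0 x i : 0 <= rate rho b x i.
Proof.
have /andP[+ _] := rate_bounds x i; apply: le_trans.
by rewrite mulr_ge0// ltW// min_rate_gt0.
Qed.

(** The shift is cyclic, which makes it injective on the whole box; it is a lattice neighbour only
    away from the upper face. *)
Definition next_site (k : 'I_d) i : site d N :=
  [ffun j => if j == k then ordS (i j) else i j].

Lemma next_site_inj k : injective (next_site k).
Proof.
move=> i j /ffunP ij; apply/ffunP => l; have := ij l; rewrite !ffunE.
by case: ifP => // _ /ordS_inj.
Qed.

Lemma pos_next_site k i : ((i k).+1 < N)%N -> pos (next_site k i) = pos i + unit_vec k.
Proof.
move=> ik; apply/ffunP => l; rewrite !ffunE; case: eqP => [->|_].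
  by rewrite /= modn_small// [LHS]intS addrC.
by rewrite addr0.
Qed.

(* Every empty site frees one of its neighbours in direction [k]: the next one,
   except on the upper face, where it frees the previous one. *)
Lemma card_empty (k : 'I_d) x : (2 <= N)%N ->
  (#|[set i | ~~ x i]| <= 2 * #|[set i | ~~ blocked x i]|)%N.
Proof.
move=> N2; set U := [set i | ~~ blocked x i].
rewrite -(cardsID [set i : site d N | (i k).+1 < N]%N) mul2n -addnn.
apply: leq_add.
  rewrite -(card_imset _ (@next_site_inj k)); apply/subset_leq_card/fintype.subsetP => _ /imsetP[i + ->].
  rewrite !inE => /andP[xi ik]; apply/forallPn; exists k.
  by rewrite pos_next_site// addrK occ_pos (negbTE xi) andbF.
(* The inverse shift sends a site of the upper face to its predecessor in direction [k], which
   [2 <= N] keeps from wrapping around. *)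
have Pinj : injective (finv (@next_site k)) by apply: finv_inj; exact: next_site_inj.
rewrite -(card_imset _ Pinj); apply/subset_leq_card/fintype.subsetP => _ /imsetP[i + ->].
rewrite !inE => /andP[ik xi]; apply/forallPn; exists k.
have E := f_finv (@next_site_inj k) i.
set j := finv _ i in E *.
have jk : ((j k).+1 < N)%N.
  move: ik; rewrite -E !ffunE eqxx /= -leqNgt => H.
  rewrite ltnNge; apply/negP => Nj.
  have e : (j k).+1 = N by apply/eqP; rewrite eqn_leq Nj ltn_ord.
  by move: H; rewrite e modnn; lia.
by rewrite -pos_next_site// E occ_pos (negbTE xi).
Qed.

Lemma occupationE x : N%:R ^+ d - occupation x = #|[set i | ~~ x i]|%:R.
Proof.
have -> : N%:R ^+ d = \sum_(i : site d N) (1 : R).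
  by rewrite sumr_const card_ffun !card_ord natrX.
rewrite -sumrB -sum1_card natr_sum [RHS]big_mkcond /=; apply: eq_bigr => i _.
by rewrite inE; case: (x i); rewrite ?subrr ?subr0.
Qed.

Lemma occupation_bounds x : 0 <= occupation x <= N%:R ^+ d.
Proof.
rewrite sumr_ge0 => [|i _]; last exact: ler0n.
by rewrite -subr_ge0 occupationE ler0n.
Qed.

(** The factor 2 is the loss in [card_empty], and each unblocked site flips at rate at least
    [min_rate]. *)
Lemma exit_rate_lb x : (0 < d)%N -> (2 <= N)%N ->
  min_rate / 2 * (N%:R ^+ d - occupation x) <= exit_rate x.
Proof.
move=> d0 N2; rewrite occupationE.
have := card_empty (Ordinal d0) x N2; rewrite -(ler_nat R).
move: #|[set i | ~~ x i]| => e; rewrite natrM => H.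
apply: (@le_trans _ _ (min_rate * #|[set i | ~~ blocked x i]|%:R)).
  rewrite -mulrA ler_wpM2l ?(ltW min_rate_gt0)//; lra.
rewrite -sum1_card natr_sum big_mkcond mulr_sumr; apply: ler_sum => i _.
by have /andP[+ _] := rate_bounds x i; rewrite inE; case: (blocked x i).
Qed.

Lemma occ_full z : occ b full z = false -> (forall i : site d N, z <> pos i) /\ b z = false.
Proof.
rewrite /occ; case: pickP => [i _|H bz]; first by rewrite ffunE.
by split => // i zi; have := H i; rewrite zi eqxx.
Qed.

(** In the full configuration only an empty boundary site can unblock a neighbour. Such a neighbour
    has its coordinate [k] forced by the face and those outside [S] forced by [a], which leaves [c]
    free coordinates. *)
Lemma exit_rate_full c : boundary_condition N c b -> exit_rate full <= N%:R ^+ c.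
Proof.
move=> [k [upper [S [a [kS cS Hb]]]]].
(* Forced coordinates, counted from 0: the layer touching the face has index [N.-1] or [0]. *)
pose v (l : 'I_d) : nat := if l == k then (if upper then N.-1 else 0%N) else a l.
pose F (l : 'I_d) : pred 'I_N := fun p => (l \in S) || (val p == v l).
have free i : ~~ blocked full i -> i \in family F.
  move=> /forallPn[l]; rewrite negb_and => H.
  have [z zE zf] : exists2 z, z = pos i + unit_vec l \/ z = pos i - unit_vec l & occ b full z = false.
    by case/orP: H => /negbTE; [exists (pos i + unit_vec l) | exists (pos i - unit_vec l)] => //; [left|right].
  have [zb bz] := occ_full zf.
  have bs : boundary_site N z by split => //; exists i, l.
  have [zk _ zS] := (Hb z bs).1 bz.
  have ik := ltn_ord (i k).
  (* A move in another direction would keep [z k] between 1 and [N], while on the face it is 0 or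
     [N.+1]. *)
  have lk : l = k.
    apply/eqP/negPn/negP => lk; have : z k = ((i k).+1)%:Z.
      by case: zE => ->; rewrite !ffunE (negbTE (_ : k != l)) 1?eq_sym// ?subr0 ?addr0.
    by rewrite zk; case: upper {zk Hb v F} => -[]; lia.
  subst l; apply/familyP => l; rewrite unfold_in /F; apply/orP.
  have [lS|lS] := boolP (l \in S); [by left | right]; rewrite /v.
  have [->|lk] := eqVneq l k.
    move: zk; case: zE => ->; rewrite !ffunE eqxx; case: upper {Hb v F} => /=; lia.
  have := zS l lk lS; case: zE => ->; rewrite !ffunE (negbTE lk) ?subr0 ?addr0 => -[e];
  by apply/eqP; exact: e.
apply: (@le_trans _ _ (\sum_(i : site d N) (~~ blocked full i)%:R)).
  by apply: ler_sum => i _; have /andP[] := rate_bounds full i.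
apply: (@le_trans _ _ (#|family F|)%:R).
  rewrite -sum1_card natr_sum [leRHS]big_mkcond; apply: ler_sum => i _.
  by case: (boolP (blocked full i)) => [_|/free ->]; rewrite //; case: ifP.
rewrite -natrX ler_nat card_family -cS.
(* The family is a product: at most [N] choices for a coordinate in [S], at most one for any
   other. *)
rewrite foldrE big_map big_enum /= -prod_nat_const [X in (_ <= X)%N]big_mkcond.
apply: leq_prod => l _; rewrite /F.
case: (l \in S); first by rewrite -[leqRHS]card_ord max_card.
apply/card_le1_eqP => p q; rewrite !unfold_in /= => /eqP pv /eqP qv.
by apply: val_inj; rewrite /= pv qv.
Qed.

End Rates.

(** * Short-time expansion of the semigroup *)

Section ShortTime.
Context {R : realType} {d N : nat} (rho : R) (b : lattice d -> bool).
Hypothesis hrho : 0 < rho < 1.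
Implicit Types (x y : config d N) (f : config d N -> R).

Local Notation K := (2 * (#|{: site d N}|)%:R : R).

(** Each site contributes a rate at most 1 times a difference at most [2 * M]. *)
Lemma generator_bound f (M : R) : (forall x, `|f x| <= M) ->
  forall x, `|generator rho b f x| <= K * M.
Proof.
move=> fM x; rewrite /generator (le_trans (ler_norm_sum _ _ _))//.
apply: (@le_trans _ _ (\sum_(i : site d N) 2 * M)).
  apply: ler_sum => i _; rewrite normrM.
  have /andP[_ r1] := rate_bounds b hrho x i.
  have r0 := rate_ge0 b hrho x i.
  have M0 : 0 <= M := le_trans (normr_ge0 _) (fM x).
  have r1' : rate rho b x i <= 1 by apply: le_trans r1 _; case: (blocked b x i).
  rewrite (ger0_norm r0) -[leRHS]mul1r ler_pM//.
  apply: (le_trans (ler_normB _ _)).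
  by have := fM x; have := fM (flip x i); lra.
by rewrite sumr_const -mulr_natr; lra.
Qed.

Lemma iter_generator_bound f (M : R) n : (forall x, `|f x| <= M) ->
  forall x, `|iter n (generator rho b) f x| <= K ^+ n * M.
Proof.
move=> fM; elim: n => [|n IH] x; first by rewrite expr0 mul1r.
by rewrite iterS exprS -mulrA; exact: generator_bound.
Qed.

(** The remainder starts at order 2, where [t ^+ n <= t ^+ 2]; what is left is dominated by [M]
    times the exponential series of [K]. *)
Lemma semigroup_taylor f (M t : R) x : (forall x, `|f x| <= M) -> 0 <= t <= 1 ->
  `|semigroup rho b t f x - (f x + t * generator rho b f x)| <= t ^+ 2 * (M * expR K).
Proof.
move=> fM /andP[t0 t1].
have M0 : 0 <= M := le_trans (normr_ge0 _) (fM x).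
have K0 : 0 <= K by rewrite mulr_ge0.
pose u n := t ^+ n / n`!%:R * iter n (generator rho b) f x.
pose v n := M * exp_coeff K n.
have uv n : `|u n| <= t ^+ n * v n.
  rewrite /u normrM ger0_norm ?divr_ge0 ?exprn_ge0// /v exp_coeffE.
  rewrite -!mulrA ler_wpM2l ?exprn_ge0// mulrCA ler_wpM2l ?invr_ge0//.
  by rewrite mulrC; apply: iter_generator_bound.
have v0 n : 0 <= v n by rewrite mulr_ge0// exp_coeff_ge0.
have cv : cvgn (series v).
  by apply: is_cvg_seriesZ; exact: is_cvg_series_exp_coeff.
have limv : limn (series v) = M * expR K.
  by rewrite lim_seriesZ//; exact: is_cvg_series_exp_coeff.
have uvn n : `|u n| <= v n.
  by apply: (le_trans (uv n)); rewrite ler_piMl// exprn_ile1.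
have cu : cvgn (series u).
  apply: normed_cvg; apply: series_le_cvg cv => // n; exact: normr_ge0.
have vle n : series v n <= M * expR K.
  rewrite -limv; apply: nondecreasing_cvgn_le => //.
  by apply: nondecreasing_series => k _ _; exact: v0.
(* The bound is proved for partial sums containing the terms of orders 0 and 1, then passed to the
   limit. *)
have part n : `|series u n.+2 - (f x + t * generator rho b f x)| <= t ^+ 2 * (M * expR K).
  apply: (@le_trans _ _ (t ^+ 2 * series v n.+2)); last first.
    by rewrite ler_wpM2l// exprn_ge0.
  elim: n => [|n IH].
    rewrite /series/= !big_nat_recr//= !big_geq// !add0r.
    have -> : u 0%N = f x by rewrite /u expr0 fact0 divr1 mul1r.
    have -> : u 1%N = t * generator rho b f x by rewrite /u expr1 divr1.
    by rewrite subrr normr0 mulr_ge0// ?exprn_ge0// addr_ge0.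
  rewrite [series u n.+3]seriesSr addrAC.
  apply: (le_trans (ler_normD _ _)); rewrite [series v n.+3]seriesSr mulrDr lerD//.
  apply: (le_trans (uv _)); rewrite ler_wpM2r//.
  by apply: ler_wiXn2l.
have cd : `|series u n - (f x + t * generator rho b f x)| @[n --> \oo] -->
    `|semigroup rho b t f x - (f x + t * generator rho b f x)|.
  by apply: cvg_norm; apply: cvgB; [exact: cu | exact: cvg_cst].
apply: (cvgr_to_le cd); exists 2%N => // n /= n2.
by rewrite -(subnK n2) addn2; exact: part.
Qed.

Lemma flip_neq x i : flip x i != x.
Proof.
by apply/eqP => /ffunP/(_ i); rewrite ffunE eqxx; case: (x i).
Qed.

Lemma generator_indicator x :
  generator rho b (fun z => (z == x)%:R) x = - exit_rate rho b x.
Proof.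
rewrite /generator /exit_rate -sumrN; apply: eq_bigr => i _.
by rewrite eqxx (negbTE (flip_neq x i)) sub0r mulrN1.
Qed.

(** Only the diagonal is expanded: the total off-diagonal mass comes later from [transition_sum]. *)
Lemma transition_diag x t : 0 <= t <= 1 ->
  `|transition rho b t x x - (1 - t * exit_rate rho b x)| <= t ^+ 2 * expR K.
Proof.
move=> t01; have fM z : `|(z == x)%:R : R| <= 1 by case: (z == x); rewrite ?normr1 ?normr0.
have := semigroup_taylor x fM t01.
by rewrite generator_indicator eqxx mulrN mul1r.
Qed.

End ShortTime.

(** * The discrete skeleton *)

Section Skeleton.
Context {R : realType} {d N : nat} (rho : R) (b : lattice d -> bool)
  {disp : measure_display} {W : measurableType disp} (P : probability W R)
  (eta : R -> W -> config d N).
Hypotheses (hrho : 0 < rho < 1) (heta : FA1f_process rho b P eta).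
Variable h : R.
Hypothesis h0 : 0 <= h.

Let p (x y : config d N) := transition rho b h x y.
Let nu := @bernoulli_weight R d N rho.
Let X (k : nat) w := eta (k%:R * h) w.

Definition cell (m : nat) (x : nat -> config d N) : set W :=
  [set w | forall k, (k <= m)%N -> X k w = x k].

Lemma bernoulli_weight_gt0 x : 0 < nu x.
Proof.
have /andP[r0 r1] := hrho.
by apply: prodr_gt0 => i _; case: (x i); rewrite // subr_gt0.
Qed.

Lemma measurable_cell m x : measurable (cell m x).
Proof.
have -> : cell m x = \bigcap_(k in `I_m.+1) [set w | X k w = x k].
  by apply/seteqP; split => w /= H k; have := H k; rewrite /= ltnS.
apply: bigcap_measurable => [|k _]; first by exists 0%N.
by apply: (FA1f_measurable heta); rewrite mulr_ge0.
Qed.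

Lemma cell_proba m x :
  P (cell m x) = (nu (x 0%N) * \prod_(k < m) p (x k) (x k.+1))%:E.
Proof.
have := @FA1f_fdd _ _ _ _ _ _ _ _ _ heta m (fun k => k%:R * h) x.
rewrite mul0r => /(_ erefl) ->.
  by congr (_ * _)%:E; apply: eq_bigr => k _; rewrite grid_step.
by move=> k; rewrite ler_wpM2r// ler_nat.
Qed.

(** The state space is finite, so this is a finite combination of indicators. *)
Lemma measurable_pair (q : config d N -> config d N -> R) k l :
  measurable_fun setT (fun w => q (X k w) (X l w)).
Proof.
have -> : (fun w => q (X k w) (X l w)) = (fun w => \sum_x \sum_y
    q x y * (\1_[set w | X k w = x] w * \1_[set w | X l w = y] w)).
  apply/funext => w; rewrite (bigD1 (X k w))//= [X in _ + X]big1 ?addr0; last first.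
    move=> x xk; apply: big1 => y _; rewrite !indicE memNset ?mul0r ?mulr0//=.
    by move=> e; rewrite e eqxx in xk.
  rewrite (bigD1 (X l w))//= big1 ?addr0; last first.
    move=> y yl; rewrite !indicE (@memNset _ [set w | X l w = y]) ?mulr0//=.
    by move=> e; rewrite e eqxx in yl.
  by rewrite !indicE !mem_set// !mulr1.
apply: measurable_sum => x; apply: measurable_sum => y.
apply: measurable_funM => //; apply: measurable_funM; apply: measurable_indic;
  by apply: (FA1f_measurable heta); rewrite mulr_ge0.
Qed.

(** * Weighted path expectations as powers of a matrix *)

Section Weights.
Variable q : config d N -> config d N -> R.
Hypothesis q0 : forall x y, 0 <= q x y.

(** The starting index [m] serves the induction of [integral_cell_weight], which moves it
    forward. *)
Definition path_weight (m n : nat) w := \prod_(k < n) q (X (m + k)%N w) (X (m + k).+1 w).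

(* Row sums of the powers of the matrix with entries [p x y * q x y]. *)
Fixpoint weighted_sum (n : nat) (x : config d N) : R :=
  if n is n'.+1 then \sum_y p x y * q x y * weighted_sum n' y else 1.

Lemma measurable_path_weight m n : measurable_fun setT (path_weight m n).
Proof. by apply: measurable_prod => k _; exact: measurable_pair. Qed.

Lemma path_weight_ge0 m n w : 0 <= path_weight m n w.
Proof. exact: prodr_ge0. Qed.

Lemma path_weightS m n w :
  path_weight m n.+1 w = q (X m w) (X m.+1 w) * path_weight m.+1 n w.
Proof.
rewrite /path_weight big_ord_recl /= addn0; congr (_ * _).
by apply: eq_bigr => k _; rewrite /bump /= add1n addnS addSn.
Qed.

Lemma measurable_cell_weight m n x :
  measurable_fun setT (fun w => \1_(cell m x) w * path_weight m n w).
Proof.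
apply: measurable_funM; first by apply: measurable_indic; exact: measurable_cell.
exact: measurable_path_weight.
Qed.

(** Integrated Markov property. The induction on [n] splits the cell by the next state [y], which
    turns the first factor of the weight into the constant [q (x m) y]. *)
Lemma integral_cell_weight n m x :
  (\int[P]_w (\1_(cell m x) w * path_weight m n w)%:E =
   (nu (x 0%N) * \prod_(k < m) p (x k) (x k.+1) * weighted_sum n (x m))%:E)%E.
Proof.
elim: n m x => [|n IH] m x.
  under eq_integral do rewrite /path_weight big_ord0 mulr1.
  by rewrite /= mulr1 integral_indic ?setIT//; [exact: cell_proba | exact: measurable_cell].
(* Only the value at [m.+1] matters; the later ones are filler. *)
pose ext y k := if (k <= m)%N then x k else y.
have split w : \1_(cell m x) w * path_weight m n.+1 w =
    \sum_y q (x m) y * (\1_(cell m.+1 (ext y)) w * path_weight m.+1 n w).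
  rewrite path_weightS; have [wc|wc] := pselect (cell m x w); last first.
    rewrite indicE memNset// mul0r big1// => y _.
    rewrite indicE memNset ?mul0r ?mulr0// => H; apply: wc => k km.
    by rewrite H ?leqW// /ext km.
  rewrite (bigD1 (X m.+1 w))//= big1 ?addr0; last first.
    move=> y yX; rewrite indicE memNset ?mul0r ?mulr0// => H.
    have := H m.+1 (leqnn _); rewrite /ext ltnn => e.
    by rewrite e eqxx in yX.
  have we : cell m.+1 (ext (X m.+1 w)) w.
    move=> k km1; rewrite /ext; case: leqP => [km|mk]; first exact: wc.
    by have -> : k = m.+1 by apply/eqP; rewrite eqn_leq km1.
  by rewrite !indicE !mem_set// !mul1r (wc m (leqnn _)).
under eq_integral do rewrite split -sumEFin.
rewrite ge0_integral_sum//; last 2 first.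
- move=> y; apply/measurable_EFinP; apply: measurable_funM => //.
  exact: measurable_cell_weight.
- by move=> y w _; rewrite lee_fin !mulr_ge0// ?indicE ?path_weight_ge0.
under eq_bigr => y _.
  under eq_integral do rewrite EFinM.
  rewrite ge0_integralZl//; last 3 first.
  - by apply/measurable_EFinP; exact: measurable_cell_weight.
  - by move=> w _; rewrite lee_fin mulr_ge0// ?indicE ?path_weight_ge0.
  - by rewrite lee_fin.
  rewrite IH -EFinM.
  over.
rewrite sumEFin /= mulr_sumr; congr EFin; apply: eq_bigr => y _.
rewrite big_ord_recr /= /ext leqnn ltnn leq0n.
under eq_bigr => k _ do rewrite (ltnW (ltn_ord k)) (ltn_ord k).
by ring.
Qed.

Lemma integral_path_weight n :
  (\int[P]_w (path_weight 0 n w)%:E = (\sum_x nu x * weighted_sum n x)%:E)%E.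
Proof.
have split w : path_weight 0 n w =
    \sum_x (\1_(cell 0 (fun=> x)) w * path_weight 0 n w).
  rewrite (bigD1 (X 0%N w))//= big1 ?addr0; last first.
    by move=> y yX; rewrite indicE memNset ?mul0r// => /(_ 0%N (leqnn _)) e; rewrite e eqxx in yX.
  by rewrite indicE mem_set ?mul1r// => k; rewrite leqn0 => /eqP ->.
under eq_integral do rewrite split -sumEFin.
rewrite ge0_integral_sum//; last 2 first.
- by move=> y; apply/measurable_EFinP; exact: measurable_cell_weight.
- by move=> y w _; rewrite lee_fin mulr_ge0// ?indicE ?path_weight_ge0.
under eq_bigr => y _ do rewrite integral_cell_weight big_ord0 mulr1.
by rewrite sumEFin.
Qed.

End Weights.

(* Read off from the process, since the law of the pair of states at times 0 and
   [h] is a probability measure; the power series is not used. *)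
Lemma transition_ge0 x y : 0 <= p x y.
Proof.
have : (0 <= P (cell 1 (fun k => if k is 0%N then x else y)))%E by exact: measure_ge0.
rewrite cell_proba big_ord1 /= lee_fin pmulr_rge0//; exact: bernoulli_weight_gt0.
Qed.

(** One step with weight 1 computes the probability of starting at [x] a second time; the positive
    factor [nu x] cancels. *)
Lemma transition_sum x : \sum_y p x y = 1.
Proof.
have q0 : forall y z : config d N, 0 <= (1 : R) by [].
have := integral_cell_weight q0 1 0 (fun=> x).
under eq_integral do rewrite /path_weight big_ord1 mulr1.
rewrite integral_indic ?setIT//; last exact: measurable_cell.
move=> /(etrans (esym (cell_proba _ _))); rewrite !big_ord0 !mulr1 /= => -[e].
apply: (mulfI (lt0r_neq0 (bernoulli_weight_gt0 x))); rewrite mulr1 [RHS]e; congr (_ * _).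
by apply: eq_bigr => y _; rewrite !mulr1.
Qed.

(** The total mass of [P], computed through the empty product. *)
Lemma bernoulli_weight_sum : \sum_x nu x = 1.
Proof.
have q0 : forall y z : config d N, 0 <= (1 : R) by [].
have := integral_path_weight q0 0.
under eq_integral do rewrite /path_weight big_ord0.
rewrite integral_cst// mul1e => /(etrans (esym (probability_setT P)))-[->].
by apply: eq_bigr => x _; rewrite mulr1.
Qed.

(** Row sums at most [M] bound [weighted_sum] by [M ^+ n] at every state, and [nu] has mass 1. *)
Lemma integral_path_weight_le (q : config d N -> config d N -> R) (M : R) n :
  (forall x y, 0 <= q x y) -> (forall x, \sum_y p x y * q x y <= M) ->
  (\int[P]_w (path_weight q 0 n w)%:E <= (M ^+ n)%:E)%E.
Proof.
move=> q0 qM; rewrite integral_path_weight// lee_fin.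
have pq0 x y : 0 <= p x y * q x y by rewrite mulr_ge0// transition_ge0.
(* Any row sum shows this; [full] provides a row. *)
have M0 : 0 <= M by apply: le_trans (qM (@full d N)); apply: sumr_ge0.
have Z0 k x : 0 <= weighted_sum q k x.
  by elim: k x => //= k IH x; apply: sumr_ge0 => y _; rewrite mulr_ge0.
have ZM k x : weighted_sum q k x <= M ^+ k.
  elim: k x => //= k IH x; rewrite exprS.
  apply: (@le_trans _ _ (\sum_y p x y * q x y * M ^+ k)).
    by apply: ler_sum => y _; rewrite ler_wpM2l.
  by rewrite -mulr_suml ler_wpM2r// exprn_ge0.
rewrite -[leRHS]mul1r -bernoulli_weight_sum mulr_suml; apply: ler_sum => x _.
by rewrite ler_wpM2l// ltW// bernoulli_weight_gt0.
Qed.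

(** All terms are nonnegative; only the trajectory that sits at [x] is kept. *)
Lemma integral_path_weight_ge (q : config d N -> config d N -> R) x n :
  (forall x y, 0 <= q x y) ->
  ((nu x * (p x x * q x x) ^+ n)%:E <= \int[P]_w (path_weight q 0 n w)%:E)%E.
Proof.
move=> q0; rewrite integral_path_weight// lee_fin.
have pq0 y z : 0 <= p y z * q y z by rewrite mulr_ge0// transition_ge0.
have Z0 k y : 0 <= weighted_sum q k y.
  by elim: k y => //= k IH y; apply: sumr_ge0 => z _; rewrite mulr_ge0.
have nu0 y : 0 <= nu y by rewrite ltW// bernoulli_weight_gt0.
rewrite (bigD1 x)//= -[leLHS]addr0 lerD//; last first.
  by apply: sumr_ge0 => y _; rewrite mulr_ge0.
rewrite ler_wpM2l//; elim: n => //= n IH; rewrite exprS (bigD1 x)//= -[leLHS]addr0 lerD//.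
  by rewrite ler_wpM2l.
by apply: sumr_ge0 => y _; rewrite mulr_ge0.
Qed.

End Skeleton.

(** * The continuous-time limit *)

(** On this range [(1 + 2 * u) * (1 - u) >= 1], and [expR (2 * u) >= 1 + 2 * u]. *)
Lemma expRN_le (R : realType) (u : R) : 0 <= u -> u <= 2^-1 -> expR (- (2 * u)) <= 1 - u.
Proof.
move=> u0 u2; rewrite expRN.
have h1 : 1 + 2 * u <= expR (2 * u) by exact: expR_ge1Dx.
have h2 : 0 < 1 + 2 * u by lra.
apply: (@le_trans _ _ (1 + 2 * u)^-1); first by rewrite lef_pV2 ?posrE ?expR_gt0.
by rewrite -[leLHS]mul1r ler_pdivrMr//; nra.
Qed.

Section Continuum.
Context {R : realType} {d N : nat} (rho : R) (b : lattice d -> bool)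
  {disp : measure_display} {W : measurableType disp} (P : probability W R)
  (eta : R -> W -> config d N).
Hypotheses (hrho : 0 < rho < 1) (heta : FA1f_process rho b P eta).
Variables (lam th T : R).
Hypotheses (lam0 : 0 <= lam) (th0 : 0 <= th) (T0 : 0 < T).

Let step (n : nat) := T / n.+1%:R.
Let Nd : R := N%:R ^+ d.

Lemma step_ge0 n : 0 <= step n.
Proof. by rewrite divr_ge0// ltW. Qed.

Lemma sum_step n : n.+1%:R * step n = T.
Proof. by rewrite mulrCA divff ?mulr1// pnatr_eq0. Qed.

(** One-step factor of the discretized [tilted_weight]: a change of state counts as one flip, and
    the empty sites are sampled at the left endpoint. *)
Definition pair_weight (h : R) (x y : config d N) : R :=
  expR (- lam * (x != y)%:R + th * (h * (Nd - occupation x))).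

(** With [th = 0] this is the tilt itself; with a positive [th], a mean at most 1 controls the time
    integral of the number of empty sites. *)
Definition tilted_weight (w : W) : R :=
  expR (- lam * (activity eta T w)%:R + th * (Nd * T - integrated_occupation eta T w)).

Let G n w := path_weight eta (step n) (pair_weight (step n)) 0 n.+1 w.

Lemma path_weightE n w : G n w =
  expR (- lam * (\sum_(k < n.+1) (eta (k%:R * step n) w != eta (k.+1%:R * step n) w))%:R
    + th * (Nd * T - step n * \sum_(k < n.+1) occupation (eta (k%:R * step n) w))).
Proof.
rewrite /G /path_weight /pair_weight -expR_sum; congr expR.
rewrite big_split /= -!mulr_sumr -natr_sum; congr (_ + _ * _).
rewrite sumrB sumr_const card_ord -mulr_natl mulrBr; congr (_ - _).
by rewrite -(sum_step n); ring.
Qed.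

Lemma path_weight_cvg w : G n w @[n --> \oo] --> tilted_weight w.
Proof.
under eq_fun do rewrite path_weightE.
have fr := FA1f_right_continuous heta w.
have fl := FA1f_left_limits heta w.
apply: continuous_cvg; first exact: continuous_expR.
apply: cvgD.
  apply: cvgMr; apply: cvg_near_cst.
  have := discrete_jump_count (f := fun t => eta t w) fr fl T0.
  by apply: filterS => n; rewrite /activity /jump_times => ->.
apply: cvgMr; apply: cvgB; first exact: cvg_cst.
exact: (riemann_sum_cvg (f := fun t => eta t w) fr fl (g := @occupation R d N) (@occupation_bounds R d N) T0).
Qed.

(** Uniform in [n] and [w]: this is the constant used for dominated convergence. *)
Lemma path_weight_bounds n w : 0 <= G n w <= expR (th * (Nd * T)).
Proof.
rewrite path_weightE expR_ge0 ler_expR -[leRHS]add0r lerD//.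
  by rewrite mulNr oppr_le0 mulr_ge0.
rewrite ler_wpM2l// gerBl mulr_ge0 ?step_ge0// sumr_ge0// => k _.
by have /andP[] := @occupation_bounds R d N (eta (k%:R * step n) w).
Qed.

Lemma measurable_tilted_weight : measurable_fun setT tilted_weight.
Proof.
apply: (measurable_fun_cvg (h := G)) => [n|w _]; last exact: path_weight_cvg.
by apply: (measurable_path_weight heta); exact: step_ge0.
Qed.

Lemma integral_path_weight_cvg :
  (\int[P]_w (G n w)%:E)%E @[n --> \oo] --> (\int[P]_w (tilted_weight w)%:E)%E.
Proof.
have [] := @dominated_convergence _ W R P setT measurableT (fun n w => (G n w)%:E)
  (fun w => (tilted_weight w)%:E) (cst (expR (th * (Nd * T)))%:E).
- move=> n; apply/measurable_EFinP; apply: (measurable_path_weight heta); exact: step_ge0.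
- by apply/measurable_EFinP; exact: measurable_tilted_weight.
- apply: aeW => w _; apply: cvg_EFin; first by apply: nearW.
  exact: path_weight_cvg.
- exact: finite_measure_integrable_cst.
- apply: aeW => w n _; have /andP[G0 GM] := path_weight_bounds n w.
  by rewrite /= lee_fin ger0_norm.
by move=> _ _.
Qed.

Lemma step_cvg0 : step n @[n --> \oo] --> (0 : R).
Proof. by rewrite -[X in _ --> X](mulr0 T); apply: cvgMr; exact: cvg_harmonic. Qed.

Let E : R := expR (2 * #|{: site d N}|%:R).

(** With [V] the number of empty sites of [x], the row sum is [(1 - a * (1 - pxx)) * expR (th * (h *
    V))]. By [1 + u <= expR u] it becomes one exponential; since [1 - pxx] is [h * r] up to
    [h ^+ 2 * E], the hypothesis on [th] makes the part linear in [h] nonpositive. *)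
Lemma pair_weight_sum (h : R) x : 0 <= h <= 1 ->
  th * (Nd - occupation x) <= (1 - expR (- lam)) * exit_rate rho b x ->
  \sum_y transition rho b h x y * pair_weight h x y <= expR (h ^+ 2 * E).
Proof.
move=> h01 thV; have /andP[h0 h1] := h01.
set a := 1 - expR (- lam) in thV.
have a0 : 0 <= a by rewrite subr_ge0 -[leRHS]expR0 ler_expR oppr_le0.
have a1 : a <= 1 by rewrite gerBl expR_ge0.
set pxx := transition rho b h x x.
have pE : \sum_(y | y != x) transition rho b h x y = 1 - pxx.
  by have := transition_sum hrho heta h0 x; rewrite (bigD1 x)//= -/pxx => <-; ring.
have diag := transition_diag b hrho x h01.
(* Off the diagonal the weight does not depend on [y], so steps with several flips need no separate
   estimate. *)
rewrite (bigD1 x)//= (eq_bigr (fun y => transition rho b h x y *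
    (expR (- lam) * expR (th * (h * (Nd - occupation x)))))); last first.
  by move=> y yx; rewrite /pair_weight eq_sym yx mulr1 expRD.
rewrite -mulr_suml pE /pair_weight eqxx mulr0 add0r -/pxx.
apply: (@le_trans _ _ (expR (- (a * (1 - pxx))) * expR (th * (h * (Nd - occupation x))))).
  rewrite [X in _ + X <= _]mulrA -mulrDl ler_wpM2r ?expR_ge0//.
  have -> : pxx + (1 - pxx) * expR (- lam) = 1 + - (a * (1 - pxx)) by rewrite /a; ring.
  exact: expR_ge1Dx.
rewrite -expRD ler_expR.
move: diag; rewrite ler_norml -/pxx -/E => /andP[_ diag].
set r := exit_rate rho b x in thV diag.
have lb : a * (h * r - h ^+ 2 * E) <= a * (1 - pxx) by rewrite ler_wpM2l//; lra.
have ub : h * (th * (Nd - occupation x)) <= h * (a * r) by rewrite ler_wpM2l.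
have he : a * (h ^+ 2 * E) <= 1 * (h ^+ 2 * E).
  by rewrite ler_wpM2r// mulr_ge0 ?exprn_ge0// expR_ge0.
by lra.
Qed.

(** Each of the [n.+1] steps loses at most [expR (step n ^+ 2 * E)], in all [expR (T * E * step n)],
    which tends to 1. *)
Lemma integral_tilted_weight_le1 :
  (forall x : config d N, th * (Nd - occupation x) <= (1 - expR (- lam)) * exit_rate rho b x) ->
  (\int[P]_w (tilted_weight w)%:E <= 1)%E.
Proof.
move=> thV.
have cv : (expR (T * E * step n))%:E @[n --> \oo] --> (1 : R)%:E.
  apply: cvg_EFin; first exact: nearW.
  rewrite -expR0; apply: continuous_cvg; first exact: continuous_expR.
  by rewrite -[X in _ --> X](mulr0 (T * E)); apply: cvgMr; exact: step_cvg0.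
apply: (lee_cvg_to integral_path_weight_cvg cv).
near=> n.
have h1 : step n <= 1 by near: n; apply: (cvgr_le 0 step_cvg0).
have h01 : 0 <= step n <= 1 by rewrite step_ge0.
apply: (le_trans (integral_path_weight_le hrho heta (step_ge0 n) (M := expR (step n ^+ 2 * E)) _ _ _)).
- by move=> x y; exact: expR_ge0.
- by move=> x; exact: pair_weight_sum.
- have -> : T * E * step n = n.+1%:R * (step n ^+ 2 * E) by rewrite -{1}(sum_step n); ring.
  by rewrite expRM_natl.
Unshelve. all: by end_near. Qed.

Lemma occupation_full : occupation (@full d N) = Nd :> R.
Proof.
rewrite /occupation (eq_bigr (fun=> 1)); last by move=> i _; rewrite ffunE.
by rewrite sumr_const card_ffun !card_ord natrX.
Qed.

(** Staying full makes no flip and has no empty site, so every factor of the weight is 1. With [h]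
    the mesh, a step stays put with probability at least [1 - h * r - h ^+ 2 * E], hence at least
    [1 - 2 * r * h], hence at least [expR (- (4 * r * h))]. *)
Lemma integral_tilted_weight_ge (r : R) : 0 < r -> exit_rate rho b (@full d N) <= r ->
  ((bernoulli_weight rho (@full d N) * expR (- (4 * r * T)))%:E <=
   \int[P]_w (tilted_weight w)%:E)%E.
Proof.
move=> r0 fr; apply: (cvge_to_ge integral_path_weight_cvg).
near=> n.
have h1 : step n <= 1 by near: n; apply: (cvgr_le 0 step_cvg0).
(* [hE] absorbs the quadratic error into a second [h * r]; [hr] puts [2 * r * h] below one half, as
   [expRN_le] requires. *)
have hE : step n <= r / E by near: n; apply: (cvgr_le 0 step_cvg0); rewrite divr_gt0// expR_gt0.
have hr : step n <= (4 * r)^-1 by near: n; apply: (cvgr_le 0 step_cvg0); rewrite invr_gt0 mulr_gt0.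
have h0 := step_ge0 n.
have h01 : 0 <= step n <= 1 by rewrite h0.
apply: le_trans (integral_path_weight_ge hrho heta h0 (@full d N) n.+1 _); last first.
  by move=> x y; exact: expR_ge0.
rewrite lee_fin ler_wpM2l ?(ltW (bernoulli_weight_gt0 hrho _))//.
rewrite /pair_weight eqxx mulr0 add0r occupation_full subrr !mulr0 expR0 mulr1.
have -> : expR (- (4 * r * T)) = expR (- (2 * (2 * r * step n))) ^+ n.+1.
  by rewrite -expRM_natl -(sum_step n); congr expR; ring.
apply: lerXn2r; rewrite ?nnegrE ?expR_ge0 ?(transition_ge0 hrho heta h0)//.
apply: (@le_trans _ _ (1 - 2 * r * step n)).
  apply: expRN_le; first by rewrite mulr_ge0// mulr_ge0// ltW.
  have : step n * (4 * r) <= 1 by rewrite -ler_pdivlMr ?mulr_gt0// div1r.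
  lra.
have := transition_diag b hrho (@full d N) h01; rewrite ler_norml -/E => /andP[diag _].
have hE' : step n * (step n * E) <= step n * r.
  by rewrite ler_wpM2l// -ler_pdivlMr// expR_gt0.
have hR : step n * exit_rate rho b (@full d N) <= step n * r by rewrite ler_wpM2l.
by move: diag; rewrite expr2; lra.
Unshelve. all: by end_near. Qed.

End Continuum.

(** * The tilted measure *)

Section TiltedProba.
Context {R : realType} {d N : nat} (rho : R) (b : lattice d -> bool)
  {disp : measure_display} {W : measurableType disp} (P : probability W R)
  (eta : R -> W -> config d N).
Hypotheses (hrho : 0 < rho < 1) (heta : FA1f_process rho b P eta).

Lemma measurable_integrated_occupation (T : R) : 0 < T ->
  measurable_fun setT (integrated_occupation eta T).
Proof.
move=> T0.
apply: (measurable_fun_cvg (h := fun n w =>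
    T / n.+1%:R * \sum_(k < n.+1) occupation (eta (k%:R * (T / n.+1%:R)) w))) => [n|w _].
  apply: measurable_funM => //; apply: measurable_sum => k.
  have h0 : 0 <= T / n.+1%:R by rewrite divr_ge0// ltW.
  exact: (measurable_pair heta h0 (fun x _ => occupation x) k k).
exact: (riemann_sum_cvg (f := fun t => eta t w) (FA1f_right_continuous heta w)
  (FA1f_left_limits heta w) (g := @occupation R d N) (@occupation_bounds R d N) T0).
Qed.

Variables (c : nat) (alpha delta th r T : R).
Let lam := - (alpha / N%:R ^+ (d - c)).
Hypotheses (lam0 : 0 <= lam) (th0 : 0 <= th) (T0 : 0 < T) (r0 : 0 < r).
Hypothesis exit_full : exit_rate rho b (@full d N) <= r.
Hypothesis exit_empty : forall x : config d N,
  th * (N%:R ^+ d - occupation x) <= (1 - expR (- lam)) * exit_rate rho b x.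

Let A := [set w | integrated_occupation eta T w >= (1 - delta) * N%:R ^+ d * T].
Let t := tilt eta c alpha T.
Let nu1 := bernoulli_weight rho (@full d N).

Lemma tiltE : t = tilted_weight eta lam 0 T.
Proof.
by apply/funext => w; rewrite /t /tilt /tilted_weight /lam opprK mul0r addr0.
Qed.

Lemma measurable_high_occupation : measurable A.
Proof.
have -> : A = integrated_occupation eta T @^-1` `[(1 - delta) * N%:R ^+ d * T, +oo[.
  by apply/seteqP; split => w; rewrite /A /= in_itv/= andbT.
rewrite -[X in measurable X]setTI.
exact: (measurable_integrated_occupation T0 measurableT (measurable_itv _)).
Qed.

Lemma measurable_tilt : measurable_fun setT t.
Proof. by rewrite tiltE; exact: (measurable_tilted_weight heta). Qed.

Lemma measurable_indic_tilt (B : set W) : measurable B ->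
  measurable_fun setT (fun w => (\1_B w * t w)%:E).
Proof.
move=> mB; apply/measurable_EFinP; apply: measurable_funM; last exact: measurable_tilt.
exact: measurable_indic.
Qed.

Lemma indic_tilt_ge0 (B : set W) w : (0 <= (\1_B w * t w)%:E)%E.
Proof. by rewrite lee_fin mulr_ge0 ?indicE// expR_ge0. Qed.

Lemma exit_rate_ge0 (x : config d N) : 0 <= exit_rate rho b x.
Proof. by apply: sumr_ge0 => i _; exact: rate_ge0. Qed.

Lemma integral_tilt_split :
  (\int[P]_w (\1_A w * t w)%:E + \int[P]_w (\1_(~` A) w * t w)%:E = \int[P]_w (t w)%:E)%E.
Proof.
rewrite -ge0_integralD//.
- apply: eq_integral => w _; rewrite -EFinD -mulrDl.
  have [wA|wA] := pselect (A w).
    by rewrite !indicE mem_set// memNset ?addr0 ?mul1r// => /(_ wA).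
  by rewrite !indicE memNset// mem_set ?add0r ?mul1r.
- by move=> w _; exact: indic_tilt_ge0.
- by apply: measurable_indic_tilt; exact: measurable_high_occupation.
- by move=> w _; exact: indic_tilt_ge0.
- by apply: measurable_indic_tilt; apply: measurableC; exact: measurable_high_occupation.
Qed.

(** Chernoff bound: off [A] the time integral of the number of empty sites exceeds
    [delta * N%:R ^+ d * T], so [t] is at most this exponential times [tilted_weight] at [th], whose
    mean is at most 1. *)
Lemma integral_low_occupation :
  (\int[P]_w (\1_(~` A) w * t w)%:E <= (expR (- (th * delta * N%:R ^+ d * T)))%:E)%E.
Proof.
apply: (@le_trans _ _ (\int[P]_w ((expR (- (th * delta * N%:R ^+ d * T)))%:E *
    (tilted_weight eta lam th T w)%:E))%E).
  apply: ge0_le_integral => //.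
  - by move=> w _; exact: indic_tilt_ge0.
  - by apply: measurable_indic_tilt; apply: measurableC; exact: measurable_high_occupation.
  - apply/measurable_EFinP; apply: measurable_funM => //.
    exact: (measurable_tilted_weight heta).
  - move=> w _; rewrite lee_fin tiltE.
    have [wA|wA] := pselect (A w).
      by rewrite indicE memNset ?mul0r ?mulr_ge0 ?expR_ge0// => /(_ wA).
    rewrite indicE mem_set// mul1r -expRD ler_expR.
    move/negP: wA; rewrite -ltNge => wA.
    have : th * integrated_occupation eta T w <= th * ((1 - delta) * N%:R ^+ d * T).
      by rewrite ler_wpM2l// ltW.
    by rewrite !mulrBl !mulrBr mul0r mul1r; lra.
rewrite ge0_integralZl_EFin ?expR_ge0//; last 2 first.
- by move=> w _; rewrite lee_fin expR_ge0.
- by apply/measurable_EFinP; exact: (measurable_tilted_weight heta).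
rewrite -[leRHS]mule1 lee_wpmul2l ?lee_fin ?expR_ge0//.
exact: (integral_tilted_weight_le1 hrho heta).
Qed.

Lemma tilted_proba_bounds :
  1 - nu1^-1 * expR (- ((th * delta * N%:R ^+ d - 4 * r) * T)) <=
    tilted_proba P eta c alpha T A <= 1.
Proof.
have nu0 : 0 < nu1 by exact: bernoulli_weight_gt0.
(* The case [th = 0]. Finiteness matters because [fine] sends an infinite partition function to
   0. *)
have Zle1 : (\int[P]_w (t w)%:E <= 1)%E.
  rewrite tiltE; apply: (integral_tilted_weight_le1 hrho heta) => // x.
  rewrite mul0r mulr_ge0 ?exit_rate_ge0// subr_ge0 -[leRHS]expR0 ler_expR.
  by rewrite oppr_le0.
have Zge : ((nu1 * expR (- (4 * r * T)))%:E <= \int[P]_w (t w)%:E)%E.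
  by rewrite tiltE; exact: (integral_tilted_weight_ge hrho heta).
have S0 : (0 <= \int[P]_w (\1_A w * t w)%:E)%E.
  by apply: integral_ge0 => w _; exact: indic_tilt_ge0.
have S'0 : (0 <= \int[P]_w (\1_(~` A) w * t w)%:E)%E.
  by apply: integral_ge0 => w _; exact: indic_tilt_ge0.
have S'le := integral_low_occupation.
have := integral_tilt_split.
rewrite /tilted_proba /tilted_mean !unlock -/A -/t.
(* The bounds and the splitting identity exclude infinite values, leaving reals with
   [S + S' = Z]. *)
move: (\int[P]_w (t w)%:E)%E (\int[P]_w (\1_A w * t w)%:E)%E
  (\int[P]_w (\1_(~` A) w * t w)%:E)%E Zle1 Zge S0 S'0 S'le => [Z| |] [S| |] [S'| |] //=.
rewrite !lee_fin => Zle1 Zge S0 S'0 S'le [ZE].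
have Z0 : 0 < Z by apply: lt_le_trans Zge; rewrite mulr_gt0// expR_gt0.
have -> : S / Z = 1 - S' / Z by rewrite -ZE; field; rewrite ZE gt_eqF.
rewrite lerD2l lerN2 gerBl divr_ge0 ?(ltW Z0)// andbT.
rewrite ler_pdivrMr//; apply: (le_trans S'le).
apply: (@le_trans _ _ (nu1^-1 * expR (- ((th * delta * N%:R ^+ d - 4 * r) * T)) * (nu1 * expR (- (4 * r * T))))); last first.
  by rewrite ler_wpM2l// mulr_ge0 ?invr_ge0 ?expR_ge0// ltW.
rewrite mulrACA mulVf ?gt_eqF// mul1r -expRD ler_expR.
by lra.
Qed.

End TiltedProba.

(** * Choice of constants and conclusion *)

(** Used with [x = N%:R ^+ (d - c)] and [y = N%:R ^+ c]. The 16 collects the 4 of the partition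
    function bound, a 2 from [1 - expR (- lam) >= lam / 2], valid as [lam <= 1], and the 2 in
    [m / 2]. *)
Lemma decay_rate_gt0 (R : realType) (alpha m delta x y : R) :
  0 < m -> 0 < delta -> 16 < - alpha * (m * delta) -> - alpha <= x -> 0 < x -> 1 <= y ->
  let lam := - (alpha / x) in let th := (1 - expR (- lam)) * (m / 2) in
  [/\ 0 <= lam, 0 <= th & 0 < th * delta * (x * y) - 4 * y].
Proof.
move=> m0 delta0 alpha16 alphax x0 y1 lam th.
have alpha0 : 0 < - alpha.
  by rewrite -(pmulr_lgt0 _ (mulr_gt0 m0 delta0)) (lt_trans _ alpha16).
have lamE : lam = - alpha / x by rewrite /lam mulNr.
have lam0 : 0 <= lam by rewrite lamE divr_ge0// ltW.
have lam1 : lam <= 1 by rewrite lamE ler_pdivrMr// mul1r.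
have lamexp : lam / 2 <= 1 - expR (- lam).
  have := @expRN_le R (lam / 2); rewrite mulrCA divff// mulr1 => H.
  by have := H ltac:(lra) ltac:(lra); lra.
have th0 : 0 <= th by rewrite mulr_ge0//; lra.
split=> //.
have : lam / 2 * (m / 2) * delta * (x * y) <= th * delta * (x * y).
  by rewrite !ler_wpM2r//; [apply: mulr_ge0 | exact: ltW | ]; lra.
have -> : lam / 2 * (m / 2) * delta * (x * y) = - alpha * (m * delta) / 4 * y.
  by rewrite lamE; field; rewrite gt_eqF.
move=> le_th; rewrite subr_gt0; apply: lt_le_trans le_th.
by rewrite ltr_pM2r; lra.
Qed.

Theorem theorem2p7 (R : realType) (rho : R) (hrho : 0 < rho < 1)
    (d : nat) (hd : (2 <= d)%N) (c : nat) (hc : (c <= d.-1)%N)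
    (delta : R) (hdelta : 0 < delta) :
  exists2 alpha1 : R, alpha1 < 0 &
  forall alpha : R, alpha < alpha1 ->
  forall (b : nat -> lattice d -> bool)
    (disp : nat -> measure_display)
    (W : forall N : nat, measurableType (disp N))
    (P : forall N : nat, probability (W N) R)
    (eta : forall N : nat, R -> W N -> config d N),
  (forall N : nat, (0 < N)%N -> boundary_condition N c (b N)) ->
  (forall N : nat, (0 < N)%N -> FA1f_process rho (b N) (P N) (eta N)) ->
  let mu (N : nat) (T : R) : R :=
    tilted_proba (P N) (eta N) c alpha T
      [set w | integrated_occupation (eta N) T w
               >= (1 - delta) * N%:R ^+ d * T] in
  (\forall N \near \oo, cvg (mu N T @[T --> +oo])) /\
  lim (mu N T @[T --> +oo]) @[N --> \oo] --> (1 : R).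
Proof.
have m0 := min_rate_gt0 hrho.
set m := min_rate rho in m0.
have md0 : 0 < m * delta by rewrite mulr_gt0.
exists (- (16 / (m * delta))) => [|alpha halpha b disp W P eta hb heta mu].
  by rewrite oppr_lt0 divr_gt0.
(* The inner limit is exactly 1 for every large [N], so the outer sequence is eventually
   constant. *)
suff main : \forall N \near \oo, mu N T @[T --> +oo] --> (1 : R).
  split; first by apply: filterS main => N; exact: cvgP.
  by apply: cvg_near_cst; apply: filterS main => N; exact: cvg_lim.
near=> N.
have N2 : (2 <= N)%N by near: N; exact: nbhs_infty_ge.
(* Together with [d - c >= 1] this makes the cost of a flip at most 1. *)
have Nalpha : - alpha <= N%:R by near: N; exact: nbhs_infty_ger.
have N0 : (0 < N)%N by apply: leq_trans N2.
have NR1 : 1 <= N%:R :> R by rewrite ler1n.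
have NR0 : 0 < N%:R :> R by rewrite ltr0n.
have alpha16 : 16 < - alpha * (m * delta).
  by rewrite -ltr_pdivrMr// ltrNr.
have d0 : (0 < d)%N by exact: ltnW.
have cd : (c < d)%N by rewrite -(prednK d0) ltnS.
have alphaN : - alpha <= N%:R ^+ (d - c).
  by rewrite (le_trans Nalpha)// -[leLHS]expr1 ler_weXn2l// subn_gt0.
have Ndc0 : 0 < N%:R ^+ (d - c) :> R by rewrite exprn_gt0.
have Nc1 : 1 <= N%:R ^+ c :> R by rewrite exprn_ege1.
have [lam0 th0] := decay_rate_gt0 m0 hdelta alpha16 alphaN Ndc0 Nc1.
rewrite -exprD subnK ?(ltnW cd)//; set lam := - (alpha / _) in lam0 th0 *.
set th := _ * (m / 2) in th0 *; set kappa := _ - _ => kappa0.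
pose nu1 := bernoulli_weight rho (@full d N).
(* At fixed [N] the factor [nu1^-1] does not depend on [T], so [expR (- (kappa * T))] beats it
   however small [nu1] is. *)
apply: (@squeeze_cvgr _ _ _ _ (fun T => 1 - nu1^-1 * expR (- (kappa * T))) (fun=> 1)).
- near=> T; have T0 : 0 < T by near: T; exact: nbhs_pinfty_gt.
  apply: (tilted_proba_bounds hrho (heta N N0)) => //.
  + by rewrite exprn_gt0.
  + apply: (exit_rate_full hrho (hb N N0)).
  + move=> x; rewrite -/lam /th -mulrA ler_wpM2l ?exit_rate_lb//.
    by rewrite subr_ge0 -[leRHS]expR0 ler_expR oppr_le0.
- rewrite -[X in _ --> X]subr0; apply: cvgB; first exact: cvg_cst.
  rewrite -[X in _ --> X](mulr0 nu1^-1); apply: cvgMr.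
  apply: (@cvg_comp _ _ _ (fun T => kappa * T) (fun x => expR (- x)) _ (pinfty_nbhs R)); last exact: cvgr_expR.
  by apply: gt0_cvgMry => //; exact: cvg_id.
- exact: cvg_cst.
Unshelve. all: by end_near. Qed.
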